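(* There exist a universal constant $C>0$ and a function $q\mapsto C_q\in(0,\infty)$ on $(2,\infty)$ such that the following holds. Let $n\in\mathbb{N}$, $q\in(2,\infty)$, and let $(Y_i)_{i=1}^n$ be i.i.d. non-negative random variables such that for all $t>0$, $$\mathbb{P}\{Y_i>t\}=(1+t)^{-q/2}.$$ Then for all $b\in[0,\infty)^n$ and all $t>0$, with probability at least $1-Ce^{-t^2/2}$, $$\sum_{i=1}^n b_iY_i\leq C_q\left(|b|_1+e^{t^2/q}|b|_{q/2}\right).$$
   Context: For $p\geq 1$, $|b|_p=\left(\sum_{i=1}^n|b_i|^p\right)^{1/p}$. The constant $C$ is universal and $C_q$ depends only on $q$. *)

(* Defs.v *)
From HB Require Import structures.
From mathcomp Require Export all_boot all_order all_algebra.
From mathcomp Require Export all_classical all_reals all_analysis.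

Set Implicit Arguments.
Unset Strict Implicit.
Unset Printing Implicit Defensive.

Import Order.TTheory GRing.Theory Num.Theory.
Import numFieldNormedType.Exports.

Local Open Scope classical_set_scope.
Local Open Scope ring_scope.

(* Mutual independence: the product rule over every subfamily [J]. For [J]
   empty it reads [P setT = 1]. *)
Definition mutually_independent (R : realType) (d : measure_display)
    (T : measurableType d) (P : probability T R) (I : finType)
    (X : I -> {RV P >-> R}) : Prop :=
  forall (J : {set I}) (A : I -> set R),
    (forall i, i \in J -> measurable (A i)) ->
    P (\bigcap_(i in [set` J]) (X i @^-1` A i)) =
      (\prod_(i in J) P (X i @^-1` A i))%E.

(* Equality of the laws is required on Borel sets only: [distribution P X] is
   a total set function, whose values on other sets carry no meaning. *)
Definition identically_distributed (R : realType) (d : measure_display)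
    (T : measurableType d) (P : probability T R) (I : finType)
    (X : I -> {RV P >-> R}) : Prop :=
  forall (i j : I) (A : set R),
    measurable A -> distribution P (X i) A = distribution P (X j) A.

Definition iid (R : realType) (d : measure_display)
    (T : measurableType d) (P : probability T R) (I : finType)
    (X : I -> {RV P >-> R}) : Prop :=
  mutually_independent X /\ identically_distributed X.

Definition pnorm (R : realType) (n : nat) (p : R) (b : 'I_n -> R) : R :=
  (\sum_(i < n) `|b i| `^ p) `^ p^-1.

(* Main.v *)
(* Write [p = q / 2], [s = expR (t ^ 2 / 2)] and rescale the weights by a
   constant times [|b|_1 + s ^ (1/p) |b|_p], so that [\sum a_i] and
   [s * \sum a_i ^ p] are at most a small constant depending on [q]. With
   probability at least [1 - 1/s] no summand [a_i Y_i] exceeds [1]. The sum of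
   the truncated summands is handled by an exponential moment of parameter
   [th = ln s / (2 (2 + p))]: the bound
   [e^(th v) <= 1 + 2 th v + e^((1 + 2 r) th) v^r] for [v <= 1], with
   [r = (1 + p) / 2], needs only the first and the [r]-th moments of [Y_i], and
   the factor [e^((1 + 2 r) th) = sqrt s] is compensated by
   [sqrt s * \sum a_i ^ r], which AM-GM bounds by the two sums above. Because
   the rescaling absorbs every [q]-dependent factor, the exponential moment is
   at most [e^(1 + th)], whence the universality of [C = 1 + e]. Replacing [Y_i]
   by its dyadic level turns the Chernoff bound into a finite union bound. *)
Require Import Defs.
From mathcomp Require Import all_boot all_order all_algebra.
From mathcomp Require Import all_classical all_reals all_analysis.
From mathcomp Require Import measurable_realfun ring lra.
Import Order.TTheory GRing.Theory Num.Theory.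
Import numFieldNormedType.Exports.
Local Open Scope classical_set_scope.
Local Open Scope ring_scope.

Set Implicit Arguments.
Unset Strict Implicit.

(** * Exponential moments of a truncated dyadic variable *)

Lemma powR_lt1 (R : realType) (a x : R) : 1 < a -> x < 0 -> a `^ x < 1.
Proof.
move=> a1 x0; rewrite /powR gt_eqF ?(lt_trans ltr01) // expR_lt1.
by rewrite nmulr_rlt0 // ln_gt0.
Qed.

(** If [2 * th * v <= 1], then [e^x <= 1 / (1 - x) <= 1 + 2 x] at [x = th * v]. Otherwise
    [1 < 2 * th * v <= e^(2 th) v], so the last term, which is [e^th] times the [r]-th power of
    [e^(2 th) v], is alone at least [e^(th v)]. *)
Lemma expR_bin_le (R : realType) (th v r : R) : 0 <= th -> 0 <= v <= 1 -> 0 <= r ->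
  expR (th * v) <= 1 + 2 * th * v + expR ((1 + 2 * r) * th) * v `^ r.
Proof.
move=> th0 /andP[v0 v1] r0; have [tv|tv] := leP (2 * th * v) 1.
  apply: (@le_trans _ _ (1 + 2 * th * v)); last first.
    by rewrite lerDl mulr_ge0 ?expR_ge0 ?powR_ge0.
  have tv0 : 0 <= th * v by rewrite mulr_ge0.
  have e1 : (1 - th * v) * expR (th * v) <= 1.
    rewrite -[leRHS](expRxMexpNx_1 (th * v)).
    by rewrite [leLHS]mulrC ler_wpM2l ?expR_ge0 //; exact: expR_ge1Dx.
  have := expR_ge0 (th * v); move: (expR _) e1 => E; nra.
have th_gt0 : 0 < th.
  by rewrite lt_neqAle th0 andbT; apply/eqP => t0; move: tv; rewrite -t0; lra.
apply: (@le_trans _ _ (expR ((1 + 2 * r) * th) * v `^ r)); last first.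
  by rewrite lerDr addr_ge0 ?mulr_ge0.
have e1 : 1 <= expR (2 * th) * v.
  apply: (le_trans (ltW tv)); rewrite ler_wpM2r //.
  by apply: le_trans (expR_ge1Dx _); rewrite lerDr.
have -> : expR ((1 + 2 * r) * th) * v `^ r = expR th * (expR (2 * th) * v) `^ r.
  rewrite powRM ?expR_ge0 // -expRM mulrA -expRD; congr (expR _ * _); ring.
apply: (@le_trans _ _ (expR th * 1)).
  by rewrite mulr1 ler_expR ler_piMr.
rewrite ler_wpM2l ?expR_ge0 //; apply: (@le_trans _ _ ((1 : R) `^ r)).
  by rewrite powR1.
rewrite ge0_ler_powR ?nnegrE //.
exact: le_trans e1.
Qed.

Lemma sum_geometric_le (R : realFieldType) (x : R) (m : nat) : 0 <= x < 1 ->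
  \sum_(k < m) x ^+ k <= (1 - x)^-1.
Proof.
move=> /andP[x0 x1]; have h : 0 < 1 - x by rewrite subr_gt0.
have e : (1 - x) * \sum_(k < m) x ^+ k = 1 - x ^+ m.
  by rewrite -opprB mulNr -subrX1 opprB.
rewrite -(ler_pM2l h) e divff ?gt_eqF // gerBl exprn_ge0 //.
Qed.

(** The exponent [r = (1 + p) / 2], midway between [1] and [p], lets both [v k * pr k] and
    [v k ^ r * pr k] decay geometrically with the common ratio [x = 2 ^ ((1 - p) / 2) < 1], since
    [1 - p <= r - p = (1 - p) / 2]. *)
Lemma mgf_dyadic_le (R : realType) (p th a : R) (m : nat) (pr : nat -> R) :
  1 < p -> 0 <= th -> 0 <= a ->
  (forall k, 0 <= pr k) -> \sum_(k < m) pr k <= 1 ->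
  (forall k, pr k <= 2 `^ (- (p * k%:R))) ->
  \sum_(k < m) expR (th * Num.min (a * 2 ^+ k.+1) 1) * pr k <=
  1 + (1 - 2 `^ ((1 - p) / 2))^-1 *
      (4 * th * a + expR ((2 + p) * th) * (2 * a) `^ ((1 + p) / 2)).
Proof.
move=> p1 th0 a0 pr0 spr prle.
set x := 2 `^ ((1 - p) / 2); set r := (1 + p) / 2; set e := expR _.
have x0 : 0 <= x by exact: powR_ge0.
have x1 : x < 1.
  by rewrite powR_lt1 ?ltr1n //; lra.
have r0 : 0 <= r by rewrite /r; lra.
pose v k : R := Num.min (a * 2 ^+ k.+1) 1.
have v01 k : 0 <= v k <= 1.
  by rewrite /v le_min ler01 ge_min lexx orbT !andbT mulr_ge0 // exprn_ge0.
have v0 k : 0 <= v k by case/andP: (v01 k).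
have vle k : v k <= (2 * a) * 2 `^ k%:R.
  rewrite /v powR_mulrn // exprS; apply: (@le_trans _ _ (a * (2 * 2 ^+ k))).
    by rewrite ge_min lexx.
  by rewrite mulrCA mulrA.
have b1 k : v k * pr k <= 2 * a * x ^+ k.
  apply: (@le_trans _ _ (2 * a * (2 `^ k%:R * 2 `^ (- (p * k%:R))))).
    by rewrite mulrA; apply: ler_pM.
  rewrite ler_wpM2l ?mulr_ge0 // -powRD ?pnatr_eq0 ?implybT //.
  rewrite -powR_mulrn // -powRrM ler_powR ?ler1n //.
  have := ler0n R k; move: (k%:R) => K; nra.
have b2 k : v k `^ r * pr k <= (2 * a) `^ r * x ^+ k.
  apply: (@le_trans _ _ ((2 * a) `^ r * ((2 `^ k%:R) `^ r * 2 `^ (- (p * k%:R))))).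
    rewrite mulrA -powRM ?powR_ge0 ?mulr_ge0 //.
    apply: ler_pM => //; first exact: powR_ge0.
    rewrite ge0_ler_powR ?nnegrE ?v0 ?mulr_ge0 ?powR_ge0 //; lra.
  rewrite ler_wpM2l ?powR_ge0 // -powRrM -powRD ?pnatr_eq0 ?implybT //.
  rewrite -powR_mulrn // -powRrM ler_powR ?ler1n //.
  by rewrite le_eqVlt; apply/orP; left; apply/eqP; rewrite /r; field.
have h0 : 0 <= 4 * th * a + e * (2 * a) `^ r.
  by rewrite addr_ge0 ?mulr_ge0 ?expR_ge0 ?powR_ge0.
apply: (@le_trans _ _ (\sum_(k < m) (pr k + (4 * th * a + e * (2 * a) `^ r) * x ^+ k))).
  apply: ler_sum => k _.
  apply: (@le_trans _ _ ((1 + 2 * th * v k + e * v k `^ r) * pr k)).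
    rewrite ler_wpM2r //; apply: le_trans (expR_bin_le th0 (v01 k) r0) _.
    suff -> : (1 + 2 * r) = 2 + p by [].
    by rewrite /r; field.
  have -> : (1 + 2 * th * v k + e * v k `^ r) * pr k =
     pr k + (2 * th * (v k * pr k) + e * (v k `^ r * pr k)) by ring.
  rewrite lerD2l [leRHS]mulrDl lerD //.
    have -> : 4 * th * a * x ^+ k = 2 * th * (2 * a * x ^+ k) by ring.
    by rewrite ler_wpM2l ?mulr_ge0.
  by rewrite -mulrA ler_wpM2l ?expR_ge0.
rewrite big_split /= lerD // -mulr_sumr mulrC ler_wpM2r //.
by apply: sum_geometric_le; rewrite x0.
Qed.

(** * Union bounds and a discrete Chernoff estimate *)

Lemma le_measure_bigsetU d (R : realType) (T : measurableType d)
  (P : {measure set T -> \bar R}) (I : Type) (s : seq I) (Q : pred I) (A : I -> set T) :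
  (forall i, measurable (A i)) ->
  (P (\big[setU/set0]_(i <- s | Q i) A i) <= \sum_(i <- s | Q i) P (A i))%E.
Proof.
move=> mA; elim: s => [|i s IH]; first by rewrite !big_nil measure0.
rewrite !big_cons; case: ifP => // _.
apply: le_trans (measureU2 _ _ _) _ => //.
  exact: bigsetU_measurable.
by rewrite leeD2l.
Qed.

(** The cells [B f] with [c <= \sum_i v i (f i)] cover [E]. Independence turns each [P (B f)] into a
    product, the factor [e^(th (\sum_i v i (f i) - c)) >= 1] relaxes the constraint on [f], and the
    free sum over [f] factorises. *)
Lemma independent_chernoff (R : realType) (d : measure_display)
    (T : measurableType d) (P : probability T R) (I K : finType)
    (X : I -> {RV P >-> R}) (A : K -> set R) (v : I -> K -> R) (th c : R) (E : set T) :
  mutually_independent X -> (forall k, measurable (A k)) -> 0 <= th ->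
  measurable E ->
  (forall w, E w -> exists2 f : {ffun I -> K},
     (forall i, A (f i) (X i w)) & c <= \sum_i v i (f i)) ->
  (P E <= (expR (- (th * c)) *
     \prod_i \sum_k (expR (th * v i k) * fine (P (X i @^-1` A k))))%:E)%E.
Proof.
move=> ind mA th0 mE Ef.
have mXA i k : measurable (X i @^-1` A k).
  exact: measurable_funPTI.
pose B (f : {ffun I -> K}) := \bigcap_(i in [set` [set: I]%SET]) (X i @^-1` A (f i)).
have mB f : measurable (B f).
  by apply: fin_bigcap_measurable => // *; exact: finite_finset.
have EB : E `<=` \big[setU/set0]_(f : {ffun I -> K} | c <= \sum_i v i (f i)) B f.
  move=> w /Ef[f Af cf]; rewrite -bigcup_pred; exists f => //=.
  by move=> i _; exact: Af.
apply: (@le_trans _ _ (\sum_(f : {ffun I -> K} | (c <= \sum_i v i (f i))%R) P (B f))%E).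
  apply: le_trans (le_measure_bigsetU _ _ _ mB).
  apply: le_measure => //; rewrite inE //.
  by apply: bigsetU_measurable => *; exact: mB.
have PB f : P (B f) = (\prod_i fine (P (X i @^-1` A (f i))))%:E.
  rewrite /B ind; last by move=> i _; exact: mA.
  rewrite -prodEFin; apply: eq_big => [i|i _]; first by rewrite finset.in_setT.
  rewrite fineK //.
  exact: fin_num_measure.
rewrite (eq_bigr _ (fun f _ => PB f)).
rewrite sumEFin lee_fin bigA_distr_bigA /= mulr_sumr big_mkcond /=.
apply: ler_sum => f _; rewrite big_split /= -expR_sum -mulr_sumr mulrA -expRD.
have p0 : 0 <= \prod_i fine (P (X i @^-1` A (f i))).
  by apply: prodr_ge0 => i _; exact: fine_ge0.
case: ifPn => [cf|_]; last by rewrite mulr_ge0 ?expR_ge0.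
rewrite -[leLHS]mul1r ler_wpM2r // -[leLHS]expR0 ler_expR addrC subr_ge0.
by rewrite ler_wpM2l.
Qed.

(** * Dyadic levels of one variable *)

(* Levels [k < N] of the decreasing scale [2 ^ k - 1], with the convention that
   level [0] is the whole line and level [N] is empty. *)
Definition dyadic_tail (R : realType) (N k : nat) : set R :=
  if k is 0 then setT else if (k < N)%N then [set y | 2 ^+ k - 1 < y] else set0.

Arguments dyadic_tail R N k : clear implicits.

(** For [0 < N] the bins [k < N] partition the line; bin [N - 1] has no upper end. *)
Definition dyadic_bin (R : realType) (N k : nat) : set R :=
  dyadic_tail R N k `\` dyadic_tail R N k.+1.

Arguments dyadic_bin R N k : clear implicits.

Lemma measurable_dyadic_tail (R : realType) (N k : nat) :
  measurable (dyadic_tail R N k).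
Proof.
case: k => [|k] /=; first exact: measurableT.
case: ifP => _; last exact: measurable0.
rewrite (_ : mkset _ = `]2 ^+ k.+1 - 1, +oo[%classic); first exact: measurable_itv.
by apply/seteqP; split=> y /=; rewrite in_itv /= andbT.
Qed.

Lemma measurable_dyadic_bin (R : realType) (N k : nat) :
  measurable (dyadic_bin R N k).
Proof. by apply: measurableD; exact: measurable_dyadic_tail. Qed.

Lemma dyadic_tailS (R : realType) (N k : nat) :
  dyadic_tail R N k.+1 `<=` dyadic_tail R N k.
Proof.
case: k => [|k] y //=; case: ifP => // kN; rewrite (ltnW kN) /=.
apply: le_lt_trans; rewrite lerD2r; apply: ler_weXn2l => //.
by rewrite ler1n.
Qed.

Lemma dyadic_bin_exists (R : realType) (N : nat) (y : R) : (0 < N)%N ->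
  exists k : 'I_N, dyadic_bin R N k y.
Proof.
move=> N0; have ex : exists k, `[< ~ dyadic_tail R N k y >].
  by exists N; apply/asboolP; case: N N0 => // N _; rewrite /= ltnn.
(* The least level that misses [y] is positive and at most [N]; its predecessor is the bin. *)
case: (ex_minnP ex) => -[|k] /asboolP nk kmin; first by case: nk.
have kN : (k < N)%N.
  apply: kmin; apply/asboolP.
  by case: (N) N0 => // N' _; rewrite /= ltnn.
exists (Ordinal kN); split => //=.
by apply: contrapT => h; have := kmin k; rewrite ltnn => /(_ (asboolT h)).
Qed.

Lemma dyadic_bin_le (R : realType) (N k : nat) (y : R) :
  (k.+1 < N)%N -> dyadic_bin R N k y -> y <= 2 ^+ k.+1.
Proof.
move=> kN [_] /=; rewrite kN /= => /negP; rewrite -leNgt => h.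
by apply: (le_trans h); rewrite gerBl.
Qed.

Section dyadic_law.
Variables (R : realType) (d : measure_display) (T : measurableType d).
Variables (P : probability T R) (Y : {RV P >-> R}).

Let mY (A : set R) : measurable A -> measurable (Y @^-1` A).
Proof. exact: measurable_funPTI. Qed.

Let F N k := fine (P (Y @^-1` dyadic_tail R N k)).

Lemma fine_dyadic_bin (N k : nat) :
  fine (P (Y @^-1` dyadic_bin R N k)) = F N k - F N k.+1.
Proof.
have mt j := mY (@measurable_dyadic_tail R N j).
rewrite (_ : _ @^-1` _ =
  Y @^-1` dyadic_tail R N k `\` Y @^-1` dyadic_tail R N k.+1) // measureD //; last first.
  by rewrite ltey_eq fin_num_measure.
rewrite setIidr ?fineB ?fin_num_measure //.
by apply: preimage_subset; exact: dyadic_tailS.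
Qed.

Lemma sum_dyadic_bin (N : nat) : (0 < N)%N ->
  \sum_(k < N) fine (P (Y @^-1` dyadic_bin R N k)) = 1.
Proof.
move=> N0; under eq_bigr do rewrite fine_dyadic_bin.
rewrite -(big_mkord xpredT (fun k => F N k - F N k.+1)).
under eq_bigr do rewrite -opprB.
rewrite sumrN telescope_sumr // opprB /F /= preimage_setT probability_setT /=.
case: N N0 => // N _; rewrite /= ltnn preimage_set0 measure0 /=.
by rewrite subr0.
Qed.

(** A bin lies in its tail set, and at [t = 2 ^ k - 1] the law [(1 + t) ^ (- p)] is exactly
    [2 ^ (- p k)]; hence the shift by [1] in the scale. *)
Lemma dyadic_bin_law_le (p : R) (N k : nat) :
  (forall t : R, 0 < t -> P [set w | t < Y w] = ((1 + t) `^ (- p))%:E) ->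
  fine (P (Y @^-1` dyadic_bin R N k)) <= 2 `^ (- (p * k%:R)).
Proof.
move=> Ytail; have mt j := mY (@measurable_dyadic_tail R N j).
have F0 j : 0 <= F N j by exact: fine_ge0.
rewrite fine_dyadic_bin; apply: (@le_trans _ _ (F N k)); first by rewrite gerBl.
rewrite /F; case: k => [|k].
  by rewrite mulr0 oppr0 powRr0 /= preimage_setT probability_setT.
rewrite /dyadic_tail; case: ifP => _; last by rewrite preimage_set0 measure0 powR_ge0.
rewrite (_ : _ @^-1` _ = [set w | 2 ^+ k.+1 - 1 < Y w]) // Ytail /=; last first.
  by rewrite subr_gt0 exprn_egt1 // ltr1n.
by rewrite addrC subrK -powR_mulrn // -powRrM mulrN mulrC.
Qed.

End dyadic_law.

(** * Normalising constant and the tail of one summand *)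

(** Large enough to absorb the geometric factor [(1 - 2 ^ ((1 - p) / 2))^-1] together with either of
    the coefficients [4] and [2 ^ ((1 + p) / 2)] of the exponential moment bound. *)
Definition tail_scale (R : realType) (p : R) : R :=
  4 * 2 `^ ((1 + p) / 2) * (1 - 2 `^ ((1 - p) / 2))^-1.

Lemma tail_scale_bounds (R : realType) (p : R) : 1 < p ->
  [/\ 1 <= tail_scale p, 4 * (1 - 2 `^ ((1 - p) / 2))^-1 <= tail_scale p &
    2 * 2 `^ ((1 + p) / 2) * (1 - 2 `^ ((1 - p) / 2))^-1 <= tail_scale p].
Proof.
move=> p1; rewrite /tail_scale.
have x0 : 0 <= 2 `^ ((1 - p) / 2) :> R by exact: powR_ge0.
have x1 : 2 `^ ((1 - p) / 2) < 1 :> R by rewrite powR_lt1 ?ltr1n //; lra.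
have r1 : 1 <= 2 `^ ((1 + p) / 2) :> R.
  by rewrite -[leLHS](powRr0 2) ler_powR ?ler1n //; lra.
have D1 : 1 <= (1 - 2 `^ ((1 - p) / 2))^-1 :> R.
  by rewrite invf_ge1 ?subr_gt0 // gerBl.
move: (_^-1) D1 => D D1; move: (2 `^ _) r1 => r r1; split; nra.
Qed.

(** For [a > 0] the probability is [(1 + 1 / a) ^ (- p)], and dropping the [1] leaves [a ^ p]. *)
Lemma tail_scaled_le (R : realType) d (T : measurableType d)
    (P : probability T R) (Y : {RV P >-> R}) (p a : R) :
  0 < p -> 0 <= a ->
  (forall t : R, 0 < t -> P [set w | t < Y w] = ((1 + t) `^ (- p))%:E) ->
  (P [set w | (1 < a * Y w)%R] <= (a `^ p)%:E)%E.
Proof.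
move=> p0; rewrite le_eqVlt => /predU1P[<-|a0] Ytail.
  rewrite (_ : mkset _ = set0) ?measure0 ?lee_fin ?powR_ge0 //.
  by apply/seteqP; split=> w //=; rewrite mul0r ltr10.
rewrite (_ : mkset _ = [set w | a^-1 < Y w]); last first.
  by apply/seteqP; split=> w /=; rewrite -ltr_pdivrMl // mulr1.
rewrite Ytail ?invr_gt0 // lee_fin powRN.
have ap : 0 < a^-1 `^ p by rewrite powR_gt0 // invr_gt0.
apply: (@le_trans _ _ (a^-1 `^ p)^-1).
  rewrite lef_pV2 ?posrE // ?powR_gt0 ?addr_gt0 ?invr_gt0 //.
  by rewrite ge0_ler_powR ?nnegrE ?addr_ge0 ?invr_ge0 ?lerDr // ltW.
by rewrite -powRN -powR_inv1 ?(ltW a0) // -powRrM mulN1r opprK.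
Qed.

(* AM-GM: [sqrt s * a ^ ((1 + p) / 2)] is the geometric mean of [a] and
   [s * a ^ p]. *)
Lemma sqrt_powR_le (R : realType) (p s a : R) : 0 < p -> 0 <= s -> 0 <= a ->
  s `^ 2^-1 * a `^ ((1 + p) / 2) <= a + s * a `^ p.
Proof.
move=> p0 s0 a0.
have sq (x y : R) : 0 <= x -> x `^ (y / 2) ^+ 2 = x `^ y.
  by move=> x0; rewrite -powR_mulrn ?powR_ge0 // -powRrM; congr (_ `^ _); field.
have -> : a `^ ((1 + p) / 2) = a `^ (1 / 2) * a `^ (p / 2).
  rewrite -powRD; first by congr (_ `^ _); field.
  by apply/implyP => /eqP h; exfalso; lra.
have := sq _ 1 a0; have := sq _ p a0; have := sq _ 1 s0.
rewrite !powRr1 // !div1r.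
move: (a `^ p) (a `^ 2^-1) (s `^ 2^-1) (a `^ (p / 2)) => A x y z <- <- <-.
have := sqr_ge0 (x - y * z); have := sqr_ge0 (x + y * z); nra.
Qed.

(** * Tail of the sum for normalised weights *)

Section weighted_sum.
Variables (R : realType) (d : measure_display) (T : measurableType d).
Variables (P : probability T R) (n : nat) (Y : 'I_n -> {RV P >-> R}).
Variables (p s : R) (a : 'I_n -> R).
Hypothesis Yind : mutually_independent Y.
Hypothesis Ytail : forall i t, 0 < t ->
  P [set w | t < Y i w] = ((1 + t) `^ (- p))%:E.
Hypotheses (p1 : 1 < p) (s1 : 1 <= s) (a0 : forall i, 0 <= a i).
Hypothesis suma : \sum_i a i <= (tail_scale p)^-1.
Hypothesis sumap : s * \sum_i a i `^ p <= (tail_scale p)^-1.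

(** With [th = ln s / (2 (2 + p))] this gives [th * K = th + ln s]: the Chernoff factor cancels the
    [e^th] of the moment bound [e^(1 + th)] and leaves [e / s]. *)
Let K := 1 + 2 * (2 + p).
Let G := \big[setU/set0]_(i < n) [set w | 1 < a i * Y i w].
Let F := [set w | K < \sum_i a i * Y i w].

Let s_gt0 : 0 < s. Proof. exact: lt_le_trans s1. Qed.

Let p_gt0 : 0 < p. Proof. exact: lt_trans p1. Qed.

Let m_aY i : measurable_fun setT (fun w => a i * Y i w).
Proof. exact: measurable_funM. Qed.

Let m_gt (f : T -> R) (c : R) : measurable_fun setT f ->
  measurable [set w | c < f w].
Proof.
move=> mf; rewrite (_ : mkset _ = setT `&` f @^-1` `]c, +oo[%classic).
  by apply: mf => //; exact: measurable_itv.
by apply/seteqP; split=> w /=; rewrite in_itv /= andbT // => -[].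
Qed.

Lemma measurable_large_sum : measurable F.
Proof. by apply: m_gt; apply: measurable_sum. Qed.

Let mG : measurable G.
Proof. by apply: bigsetU_measurable => i _; exact: m_gt. Qed.

Lemma large_summand_le : (P G <= (s^-1)%:E)%E.
Proof.
apply: le_trans (le_measure_bigsetU _ _ _ _) _; first by move=> i; exact: m_gt.
apply: (@le_trans _ _ (\sum_(i < n) (a i `^ p)%:E)%E).
  by apply: lee_sum => i _; exact: (tail_scaled_le p_gt0 (a0 i) (Ytail i)).
rewrite sumEFin lee_fin -(ler_pM2l s_gt0) divff ?gt_eqF //.
have [M1 _ _] := tail_scale_bounds p1.
by apply: (le_trans sumap); rewrite invf_le1 // (lt_le_trans ltr01).
Qed.

Lemma truncated_sum_le : (P (F `\` G) <= (expR 1 * s^-1)%:E)%E.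
Proof.
pose th := ln s / (2 * (2 + p)).
have th0 : 0 <= th.
  by rewrite divr_ge0 ?ln_ge0 //; move: p1; lra.
(* [2 ^ N] exceeds every [(a i)^-1], so on the unbounded top bin the cap [1] in [v] below is
   attained whenever [a i > 0]; a zero weight adds [0^-1 = 0] to the sum. *)
pose N := (Num.truncn (\sum_i (a i)^-1)).+1.
have aN i : 0 < a i -> 1 <= a i * 2 ^+ N.
  move=> ai; rewrite -ler_pdivrMl // mulr1.
  apply: (@le_trans _ _ (\sum_i (a i)^-1)).
    by rewrite (bigD1 i) //= lerDl sumr_ge0 // => j _; rewrite invr_ge0.
  apply: (le_trans (ltW (truncnS_gt _))).
  by rewrite -natrX ler_nat ltnW // ltn_expl.
(* Off [G] this bounds [a i * Y i] on bin [k]. *)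
pose v i (k : 'I_N) : R := Num.min (a i * 2 ^+ k.+1) 1.
have cover w : (F `\` G) w -> exists2 f : {ffun 'I_n -> 'I_N},
     (forall i, dyadic_bin R N (f i) (Y i w)) & K <= \sum_i v i (f i).
  move=> [Fw Gw].
  have aY1 i : a i * Y i w <= 1.
    rewrite leNgt; apply/negP => h; apply: Gw.
    by rewrite /G (bigD1 i) //=; left.
  have /choice[g gP] i : exists k : 'I_N, dyadic_bin R N k (Y i w).
    exact: dyadic_bin_exists.
  exists [ffun i => g i] => [i|]; first by rewrite ffunE.
  apply: (le_trans (ltW Fw)); apply: ler_sum => i _; rewrite ffunE /v.
  rewrite le_min aY1 andbT.
  have [kN|Nk] := ltnP (g i).+1 N.
    by rewrite ler_wpM2l //; exact: dyadic_bin_le kN _.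
  have -> : (g i).+1 = N by apply/eqP; rewrite eqn_leq ltn_ord.
  have := a0 i; rewrite le_eqVlt => /predU1P[<-|ai]; first by rewrite !mul0r.
  exact: le_trans (aY1 i) (aN i ai).
have mFG : measurable (F `\` G) by apply: measurableD => //; exact: measurable_large_sum.
apply: (le_trans (independent_chernoff (A := fun k : 'I_N => dyadic_bin R N k)
  Yind _ th0 mFG cover)).
  by move=> k; exact: measurable_dyadic_bin.
set D := (1 - 2 `^ ((1 - p) / 2))^-1.
have D0 : 0 <= D.
  rewrite invr_ge0 subr_ge0 ltW // powR_lt1 ?ltr1n //; move: p1; lra.
have eth : expR ((2 + p) * th) = s `^ 2^-1.
  rewrite /powR gt_eqF //; congr expR; rewrite /th; field.
  by move: p1; lra.
(* The excess over [1] in [mgf_dyadic_le], after AM-GM; [1 + u i <= e^(u i)] then turns the product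
   over [i] into a sum in the exponent. *)
pose u i := D * (4 * th * a i + 2 `^ ((1 + p) / 2) * (a i + s * a i `^ p)).
have u_le i : \sum_k expR (th * v i k) * fine (P (Y i @^-1` dyadic_bin R N k)) <= expR (u i).
  apply: le_trans (mgf_dyadic_le (m := N)
    (pr := fun k => fine (P (Y i @^-1` dyadic_bin R N k))) p1 th0 (a0 i) _ _ _) _.
  - by move=> k; exact: fine_ge0.
  - by rewrite sum_dyadic_bin.
  - by move=> k; exact: (dyadic_bin_law_le _ _ (Ytail i)).
  apply: le_trans (expR_ge1Dx _); rewrite lerD2l ler_wpM2l // lerD2l eth.
  rewrite powRM // mulrCA ler_wpM2l ?powR_ge0 //.
  exact: (sqrt_powR_le p_gt0 (ltW s_gt0) (a0 i)).
rewrite lee_fin; apply: (@le_trans _ _ (expR (- (th * K)) * \prod_i expR (u i))).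
  rewrite ler_wpM2l ?expR_ge0 //; apply: ler_prod => i _; rewrite u_le andbT.
  by apply: sumr_ge0 => k _; rewrite mulr_ge0 ?expR_ge0 ?fine_ge0.
(* The terms with [4 * th] add up to at most [th], the others to at most [1], because [tail_scale p]
   absorbs the coefficients. *)
have su : \sum_i u i <= th + 1.
  have [M1 M2 M3] := tail_scale_bounds p1.
  have M0 : 0 < tail_scale p by exact: lt_le_trans M1.
  have {u_le} -> : \sum_i u i = D * (4 * th * \sum_i a i +
      2 `^ ((1 + p) / 2) * (\sum_i a i + s * \sum_i a i `^ p)).
    by rewrite -mulr_sumr big_split /= -!mulr_sumr big_split /= -mulr_sumr.
  have A1 : 4 * D * \sum_i a i <= 1.
    apply: (@le_trans _ _ (tail_scale p * (tail_scale p)^-1)).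
      by apply: ler_pM => //; rewrite ?mulr_ge0 ?sumr_ge0.
    by rewrite divff // gt_eqF.
  have A2 : 2 * 2 `^ ((1 + p) / 2) * D * (\sum_i a i + s * \sum_i a i `^ p) <= 2.
    apply: (@le_trans _ _ (tail_scale p * ((tail_scale p)^-1 + (tail_scale p)^-1))).
      apply: ler_pM => //; last exact: lerD.
        by rewrite ?mulr_ge0 ?powR_ge0.
      rewrite addr_ge0 ?mulr_ge0 ?sumr_ge0 // ?(ltW s_gt0) // => i _.
      exact: powR_ge0.
    by rewrite mulrDr divff ?gt_eqF.
  move: A1 A2; move: (\sum_i a i) (s * _) (2 `^ _) => A B r A1 A2.
  have := ler_wpM2l th0 A1; lra.
rewrite -expR_sum -expRD (_ : expR 1 * s^-1 = expR (1 - ln s)); last first.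
  by rewrite expRD expRN lnK.
rewrite ler_expR.
have -> : ln s = th * (2 * (2 + p)) by rewrite /th divfK //; move: p1; lra.
by move: su; rewrite /K; lra.
Qed.

Lemma weighted_sum_tail : (P F <= ((1 + expR 1) * s^-1)%:E)%E.
Proof.
have mF := measurable_large_sum.
have mFG : measurable (F `\` G) by exact: measurableD.
apply: (@le_trans _ _ (P (G `|` F `\` G))).
  apply: le_measure; rewrite ?inE //; first exact: measurableU.
  by move=> w Fw; have [Gw|Gw] := pselect (G w); [left|right].
apply: le_trans (measureU2 _ mG mFG) _.
rewrite mulrDl mul1r EFinD; apply: leeD; first exact: large_summand_le.
exact: truncated_sum_le.
Qed.

End weighted_sum.

(** * Rescaling arbitrary weights *)

Unset Implicit Arguments.
Set Strict Implicit.

Theorem proposition21 (R : realType) :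
  exists (C : R) (Cq : R -> R),
    0 < C /\
    (forall q : R, 2 < q -> 0 < Cq q) /\
    forall (n : nat) (q : R), 2 < q ->
    forall (d : measure_display) (T : measurableType d) (P : probability T R)
      (Y : 'I_n -> {RV P >-> R}),
      iid Y ->
      (forall (i : 'I_n) (w : T), 0 <= Y i w) ->
      (forall (i : 'I_n) (t : R), 0 < t ->
         P [set w | t < Y i w] = ((1 + t) `^ (- (q / 2)))%:E) ->
      forall (b : 'I_n -> R), (forall i, 0 <= b i) ->
      forall t : R, 0 < t ->
        ((1 - C * expR (- (t ^+ 2 / 2)))%:E <=
         P [set w | (\sum_(i < n) b i * Y i w <=
              Cq q * (pnorm 1 b + expR (t ^+ 2 / q) * pnorm (q / 2) b))%R])%E.
Proof.
have C0 : 0 < 1 + expR 1 :> R by rewrite addr_gt0 ?expR_gt0.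
(* In [C], the [1] pays for large summands and [e] for the truncated sum; [Cq q] is the threshold
   [K] times the normaliser, at [p = q / 2]. *)
exists (1 + expR 1),
  (fun q => (1 + 2 * (2 + q / 2)) * tail_scale (q / 2)); split=> //.
have M1 (q : R) : 2 < q -> 1 <= tail_scale (q / 2).
  by move=> q2; have [] // := @tail_scale_bounds R (q / 2); lra.
split=> [q q2|n q q2 d T P Y [Yind _] Y0 Ytail b b0 t t0].
  by rewrite mulr_gt0 ?(lt_le_trans ltr01 (M1 _ q2)) //; lra.
set s := expR (t ^+ 2 / 2); set p := q / 2.
have p1 : 1 < p by rewrite /p; lra.
have s0 : 0 < s by exact: expR_gt0.
have s1 : 1 <= s by rewrite -expR0 ler_expR divr_ge0 ?sqr_ge0.
set w := (pnorm 1 b + _); set M := tail_scale p.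
have M_ge1 : 1 <= M by exact: M1.
have M0 : 0 < M by exact: lt_le_trans M_ge1.
have b1 : pnorm 1 b = \sum_i b i.
  rewrite /pnorm invr1 powRr1; last by apply: sumr_ge0 => i _; exact: powR_ge0.
  by apply: eq_bigr => i _; rewrite ger0_norm // powRr1.
have sb0 : 0 <= \sum_i b i `^ p by apply: sumr_ge0 => i _; exact: powR_ge0.
(* Since [t ^ 2 / q = (t ^ 2 / 2) / p], the power [p] turns the exponential factor into [s]. *)
have bp : (expR (t ^+ 2 / q) * pnorm p b) `^ p = s * \sum_i b i `^ p.
  have -> : t ^+ 2 / q = t ^+ 2 / 2 / p by rewrite /p; field; move: q2; lra.
  have bE : \sum_i `|b i| `^ p = \sum_i b i `^ p.
    by apply: eq_bigr => i _; rewrite ger0_norm.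
  have p0 : p != 0 by rewrite gt_eqF // (lt_trans ltr01).
  by rewrite powRM ?expR_ge0 ?powR_ge0 // -expRM divfK // /pnorm bE -powRrM mulVf // powRr1.
have wp0 : 0 <= expR (t ^+ 2 / q) * pnorm p b.
  by rewrite mulr_ge0 ?expR_ge0 ?powR_ge0.
have b_ge0 : 0 <= \sum_i b i by exact: sumr_ge0.
(* If [w <= 0], all weights vanish and the event is the whole space; otherwise division by [w] makes
   sense. *)
rewrite expRN -/s; have [w0|w0] := leP w 0.
  rewrite (_ : mkset _ = setT) ?probability_setT ?lee_fin.
    by rewrite gerBl divr_ge0 ?ltW.
  have bi0 i : b i = 0.
    apply/eqP; rewrite eq_le b0 andbT (le_trans _ w0) // /w b1.
    rewrite (bigD1 i) //= -addrA lerDl addr_ge0 ?sumr_ge0 //.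
  have -> : w = 0 by apply/eqP; rewrite eq_le w0 /w b1 addr_ge0.
  apply/seteqP; split=> z //= _; rewrite mulr0 big1 // => i _.
  by rewrite bi0 mul0r.
have Mw0 : 0 < M * w by rewrite mulr_gt0.
pose a i := b i / (M * w).
have a0 i : 0 <= a i by rewrite divr_ge0 // ltW.
have suma : \sum_i a i <= M^-1.
  rewrite -mulr_suml invfM mulrCA ler_piMr ?invr_ge0 ?(ltW M0) //.
  by rewrite ler_pdivrMr // mul1r /w b1 lerDl.
(* Here [M <= M ^ p], as [1 <= M] and [1 < p], so the one rescaling by [M * w] serves both sums. *)
have sumap : s * \sum_i a i `^ p <= M^-1.
  have -> : \sum_i a i `^ p = (\sum_i b i `^ p) / (M * w) `^ p.
    rewrite mulr_suml; apply: eq_bigr => i _.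
    rewrite /a powRM ?invr_ge0 ?(ltW Mw0) //; congr (_ * _).
    by rewrite -powR_inv1 ?(ltW Mw0) // -powRrM mulN1r powRN.
  rewrite mulrA ler_pdivrMr ?powR_gt0 // [leRHS]mulrC ler_pdivlMr //.
  rewrite powRM ?(ltW M0) ?(ltW w0) // mulrC -bp; apply: ler_pM => //.
  - exact: ltW.
  - exact: powR_ge0.
  - by rewrite le1r_powR // ltW.
  - rewrite ge0_ler_powR ?nnegrE ?(ltW w0) ?(le_trans ler01 (ltW p1)) //.
    by rewrite /w lerDr b1.
have := weighted_sum_tail Yind Ytail p1 s1 a0 suma sumap.
set F := mkset _ => PF.
have mF : measurable F by exact: measurable_large_sum.
rewrite (_ : mkset _ = ~` F); last first.
  have aY z : (\sum_i a i * Y i z <= 1 + 2 * (2 + p)) =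
      (\sum_i b i * Y i z <= (1 + 2 * (2 + p)) * M * w).
    rewrite -mulrA -ler_pdivrMr // mulr_suml; congr (_ <= _).
    by apply: eq_bigr => i _; rewrite mulrAC.
  by apply/seteqP; split=> z; rewrite /F /= -aY leNgt => /negP.
rewrite probability_setC // -[in leRHS](fineK (fin_num_measure P _ mF)).
rewrite -EFinB lee_fin lerD2l lerN2 -lee_fin fineK ?fin_num_measure //.
Qed.
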